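(* There is no infinite parameterized-square-free word.
   Context: A parameterized square is a word $uv$ with $|u|=|v|\ge 1$ and a bijection $f:\mathrm{Alph}(u)\to\mathrm{Alph}(v)$ ($\mathrm{Alph}$ = set of letters occurring) with $v[t]=f(u[t])$ for all $t$. A (finite or infinite) word is parameterized-square-free if none of its finite factors is a parameterized square of length greater than $3$. *)

(* Defs.v *)
From mathcomp Require Import all_boot.
Set Implicit Arguments. Unset Strict Implicit. Unset Printing Implicit Defensive.

(* Alph(u) is the subtype [seq_sub u] of the letters occurring in u. *)
Definition pmatch (A : eqType) (u v : seq A) : Prop :=
  exists f : seq_sub u -> seq_sub v,
    bijective f /\
    forall (t : nat) (a : seq_sub u),
      onth u t = Some (val a) -> onth v t = Some (val (f a)).

Definition psquare (A : eqType) (s : seq A) : Prop :=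
  exists u v : seq A,
    [/\ s = u ++ v, size u = size v, 1 <= size u & pmatch u v].

Definition inf_word (A : Type) : Type := nat -> A.

Definition factor_of (A : Type) (s : seq A) (w : inf_word A) : Prop :=
  exists i n : nat, s = mkseq (fun t => w (i + t)) n.

Definition psquare_free (A : eqType) (w : inf_word A) : Prop :=
  forall s : seq A, factor_of s w -> ~ (psquare s /\ 3 < size s).

(* Main.v *)
(** Factors of length 4 force [w i = w i.+1] to alternate with [w i.+2 = w i.+3]:
    two blocks of length 2 match as soon as both or neither are constant.  Hence
    the equality pattern of adjacent letters has the form 11001100..., and [w]
    reads [aaab cccd ...] from some position on, with [a <> b] and [c <> d]; these
    eight letters form a parameterized square. *)

Require Import Defs.
From mathcomp Require Import all_boot.

Set Implicit Arguments.
Unset Strict Implicit.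
Unset Printing Implicit Defensive.

Section ParameterizedMatching.

Variable A : eqType.

(** A bijection-free form of matching: for explicit blocks it leaves only comparisons of letters at
    given positions. *)
Definition same_pattern (x0 : A) (u v : seq A) : Prop :=
  forall i j, i < size u -> j < size u ->
    (nth x0 u i == nth x0 u j) = (nth x0 v i == nth x0 v j).

Lemma transport_subproof (x0 : A) (u v : seq A) (a : seq_sub u) :
  size u = size v -> nth x0 v (index (val a) u) \in v.
Proof. by move=> eq_uv; rewrite mem_nth // -eq_uv index_mem (valP a). Qed.

Definition transport (x0 : A) (u v : seq A) (eq_uv : size u = size v)
    (a : seq_sub u) : seq_sub v :=
  SeqSub (transport_subproof x0 a eq_uv).

(** [transport] looks at the first occurrence of a letter, but any occurrence serves: equal letters
    at two positions of [u] force equal letters at the same positions of [v]. *)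
Lemma transport_nth (x0 : A) (u v : seq A) (eq_uv : size u = size v)
    (a : seq_sub u) (t : nat) :
  same_pattern x0 u v -> t < size u -> nth x0 u t = val a ->
  val (transport x0 eq_uv a) = nth x0 v t.
Proof.
move=> uv ltt eqa; have au : val a \in u := valP a.
by apply/eqP; rewrite /= -uv ?index_mem // nth_index // eqa.
Qed.

Lemma transportK (x0 : A) (u v : seq A) (eq_uv : size u = size v)
    (eq_vu : size v = size u) :
  same_pattern x0 v u -> cancel (transport x0 eq_uv) (transport x0 eq_vu).
Proof.
move=> vu a; have au : val a \in u := valP a; apply: val_inj.
(* The position where [a] first occurs in [u] carries its image in [v], so transporting back may be
   computed there, which returns [a]. *)
have ltv : index (val a) u < size v by rewrite -eq_uv index_mem.
by rewrite (transport_nth eq_vu vu ltv) ?nth_index.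
Qed.

Lemma same_pattern_sym (x0 : A) (u v : seq A) :
  size u = size v -> same_pattern x0 u v -> same_pattern x0 v u.
Proof. by move=> eq_uv uv i j lti ltj; rewrite uv ?eq_uv. Qed.

Lemma pmatch_same_pattern (x0 : A) (u v : seq A) :
  size u = size v -> same_pattern x0 u v -> pmatch u v.
Proof.
move=> eq_uv uv; have vu := same_pattern_sym eq_uv uv.
exists (transport x0 eq_uv); split.
  by exists (transport x0 (esym eq_uv)); apply: transportK.
move=> t a ut; have ltt : t < size u.
  by rewrite ltnNge; apply/negP => le_ut; rewrite onth_default in ut.
have eqa := onth_nth x0 _ _ _ ut.
by rewrite (transport_nth eq_uv uv ltt eqa) onthE (nth_map x0) // -eq_uv.
Qed.

Lemma psquare_free_pattern (w : inf_word A) (i n : nat) :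
  psquare_free w -> 1 < n ->
  ~ (forall s t, s < n -> t < n ->
       (w (i + s) == w (i + t)) = (w (i + n + s) == w (i + n + t))).
Proof.
move=> free gt1n eqw.
pose block j := mkseq (fun t => w (j + t)) n.
apply: (free (block i ++ block (i + n))).
  exists i, (n + n); rewrite /mkseq iotaD map_cat; congr (_ ++ _).
  rewrite add0n -[X in iota X n]addn0 iotaDl -map_comp.
  by apply: eq_map => t /=; rewrite addnA.
(* The bound [1 < n] makes the length [n + n] at least 4, hence greater than 3. *)
split; last by rewrite size_cat !size_mkseq (leq_add (m1 := 2) (m2 := 2)).
exists (block i), (block (i + n)); rewrite !size_mkseq; split=> //.
  exact: ltnW.
apply: (@pmatch_same_pattern (w 0)); first by rewrite !size_mkseq.
by move=> s t; rewrite size_mkseq => lts ltt; rewrite !nth_mkseq // eqw.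
Qed.

Lemma adjacent_eq_alternates (w : inf_word A) (i : nat) :
  psquare_free w -> (w i.+2 == w i.+3) = (w i != w i.+1).
Proof.
move=> free.
have [|neq_e] := eqVneq (w i == w i.+1) (w i.+2 == w i.+3); last first.
  by move: neq_e; case: (w i == _); case: (w i.+2 == _).
(* In blocks of length 2 the only nontrivial comparison is the one settled by [eq_e]. *)
move=> eq_e; case: (psquare_free_pattern (i := i) free (ltnSn 1)).
move=> [|[|s]] [|[|t]] //= _ _; rewrite ?addnS !addn0 ?eqxx //.
by rewrite eq_sym eq_e eq_sym.
Qed.

Lemma no_three_consecutive_equal (w : inf_word A) (i : nat) :
  psquare_free w -> w i = w i.+1 -> w i.+1 = w i.+2 -> False.
Proof.
move=> free e0 e1; have alt j := adjacent_eq_alternates j free.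
have n2 := alt i; have n3 := alt i.+1; have e4 := alt i.+2; have e5 := alt i.+3.
have n6 := alt i.+4.
rewrite e0 eqxx in n2; rewrite e1 eqxx in n3; rewrite n2 in e4.
rewrite n3 in e5; rewrite e4 in n6.
have {}e4 := eqP e4; have {}e5 := eqP e5.
(* The letters from [i] on now read aaab cccd: [e0] and [e1] give aaa, [e4] and [e5] give ccc, while
   [n2] and [n6] say that the fourth letter of each block differs from the others. *)
apply: (psquare_free_pattern (i := i) (n := 4) free) => // s t.
move: s t => [|[|[|[|s]]]] [|[|[|[|t]]]] //= _ _; rewrite ?addnS !addn0.
all: rewrite ?e0 ?e1 ?e4 ?e5 ?eqxx ?n2 ?n6 //.
all: by rewrite eq_sym n2 eq_sym n6.
Qed.

End ParameterizedMatching.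

Theorem theorem33 (A : eqType) : ~ exists w : inf_word A, psquare_free w.
Proof.
move=> [w free]; have alt j := adjacent_eq_alternates j free.
have absurd i : w i == w i.+1 -> w i.+1 == w i.+2 -> False.
  by move=> /eqP e0 /eqP e1; apply: no_three_consecutive_equal free e0 e1.
(* By [alt], the equality bits of adjacent letters run p, q, not p, not q, p. For each choice of p
   and q, two neighbouring bits among these five are true, so four starting points suffice. *)
have := absurd 0; have := absurd 1; have := absurd 2; have := absurd 3.
rewrite !alt; case: (w 0 == w 1); case: (w 1 == w 2) => /= h3 h2 h1 h0.
- exact: h0.
- exact: h3.
- exact: h1.
- exact: h2.
Qed.
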